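(* Consider the one-dimensional SDE $$dX_t=b(t,X_t)\,dt+\sigma(t,X_t)\,dW_t,\qquad X_0\ge0\ \text{a.s.},$$ and suppose that: (i) its solution exists and is unique; (ii) $\sigma(t,x)$ has polynomial growth in $x$, and there is $K$ such that $(x-y)(b(t,x)-b(t,y))\le K|x-y|^2$ for all $t\ge0$, $x,y\in\mathbb R$; (iii) $b(t,0)\ge0$ and $\sigma(t,0)=0$ for all $t\ge0$. Put $\hat b(t,x)=b(t,x)-b(t,0)$. Suppose the tamed coefficients satisfy, for some $\mu,\alpha>0$ (independent of $h$), $$|\hat b^h(t,x)|\,h^\alpha\vee|\sigma^h(t,x)|\,h^{\alpha/2}\le\mu|x|,\qquad\forall t\ge0,\ x\in\mathbb R.$$ Then, if $\alpha<1$ and $h$ is sufficiently small, the tamed Euler scheme $$\bar X_{k+1}=\bar X_k+b^h(t_k,\bar X_k)h+\sigma^h(t_k,\bar X_k)\sqrt h\,\zeta_h,\qquad\bar X_0=X_0,$$ is almost surely non-negative, i.e. $\bar X_k\ge0$ a.s. for all $k\ge0$.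
   Context: $W$ is a one-dimensional Wiener process. $h>0$ is the step size and $t_k=kh$. For each $h$, $\hat b^h,\sigma^h:[0,\infty)\times\mathbb R\to\mathbb R$ are tamed versions of $\hat b,\sigma$ (measurable functions), and the tamed drift is $b^h(t,x)=b(t,0)+\hat b^h(t,x)$. In each step, $\zeta_h$ denotes the truncation of a fresh standard normal variable $\xi\sim N(0,1)$: $\zeta_h=A_h$ if $\xi>A_h$, $\zeta_h=\xi$ if $-A_h\le\xi\le A_h$, $\zeta_h=-A_h$ if $\xi<-A_h$, where $A_h=\sqrt{2|\log h|}$. $a\vee b=\max(a,b)$. *)

(* Defs.v *)
From mathcomp Require Export all_boot all_order all_algebra.
From mathcomp Require Export all_classical all_reals all_analysis.

Set Implicit Arguments.
Unset Strict Implicit.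
Unset Printing Implicit Defensive.

Import Order.TTheory GRing.Theory Num.Theory.
Export numFieldNormedType.Exports.

Local Open Scope classical_set_scope.
Local Open Scope ring_scope.

(* Time is [0, +oo[; a function of time has type R -> _ and only its values
   at times t >= 0 matter.  A process is indexed as X t w. *)

Section filtered_space.
Context d (T : measurableType d) (R : realType).

Record is_filtration (F : R -> set_system T) : Prop := IsFiltration {
  filtration_sigma_algebra : forall t : R, 0 <= t -> sigma_algebra setT (F t) ;
  filtration_measurable : forall t : R, 0 <= t -> F t `<=` measurable ;
  filtration_nondecreasing : forall s t : R, 0 <= s -> s <= t -> F s `<=` F t }.

Definition sub_measurable (G : set_system T) (f : T -> R) : Prop :=
  forall B : set R, measurable B -> G (f @^-1` B).

Definition adapted (F : R -> set_system T) (X : R -> T -> R) : Prop :=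
  forall t : R, 0 <= t -> sub_measurable (F t) (X t).

(* For every t >= 0, the restriction of X to [0, t] * T is measurable with
   respect to the product sigma-algebra of the Borel sets and F t. *)
Definition progressive (F : R -> set_system T) (X : R -> T -> R) : Prop :=
  forall t : R, 0 <= t -> forall B : set R, measurable B ->
    <<s [set C | exists A E, [/\ measurable (A : set R), F t E & C = A `*` E]] >>
      [set p | 0 <= p.1 <= t /\ B (X p.1 p.2)].

End filtered_space.

Section stochastic_calculus.
Context d (T : measurableType d) (R : realType) (P : probability T R).

(* [normal_prob m s] has standard deviation s, not variance s. *)
Definition normally_distributed (m s : R) (Y : T -> R) : Prop :=
  forall B : set R, measurable B -> P (Y @^-1` B) = normal_prob m s B.

Definition ae_continuous (X : R -> T -> R) : Prop :=
  {ae P, forall w, {within `[0, +oo[, continuous (fun t => X t w)}}.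

Record is_wiener (F : R -> set_system T) (W : R -> T -> R) : Prop := IsWiener {
  wiener_adapted : adapted F W ;
  wiener_start : {ae P, forall w, W 0 w = 0} ;
  wiener_continuous : ae_continuous W ;
  wiener_increment : forall s t : R, 0 <= s -> s < t ->
    normally_distributed 0 (Num.sqrt (t - s)) (W t \- W s) ;
  wiener_independent : forall s t : R, 0 <= s -> s < t ->
    forall (A : set T) (B : set R), F s A -> measurable B ->
      P (A `&` (W t \- W s)%R @^-1` B) = (P A * P ((W t \- W s)%R @^-1` B))%E }.

(* The elementary process
     H_t = \sum_(i < n) phi_i * 1_{]t_i, t_(i+1)]}(t). *)
Record simple_process := SimpleProcess {
  simple_size : nat ;
  simple_time : nat -> R ;
  simple_coef : nat -> T -> R }.

Definition is_simple (F : R -> set_system T) (S : simple_process) : Prop :=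
  [/\ 0 <= simple_time S 0,
      forall i, (i < simple_size S)%N -> simple_time S i < simple_time S i.+1,
      forall i, (i < simple_size S)%N ->
        sub_measurable (F (simple_time S i)) (simple_coef S i) &
      forall i, (i < simple_size S)%N ->
        exists M : R, forall w, `|simple_coef S i w| <= M].

Definition simple_eval (S : simple_process) (t : R) (w : T) : R :=
  \sum_(i < simple_size S)
    simple_coef S i w * \1_(`]simple_time S i, simple_time S i.+1]) t.

Definition simple_integral (W : R -> T -> R) (S : simple_process) (t : R)
    (w : T) : R :=
  \sum_(i < simple_size S) simple_coef S i w *
    (W (Num.min (simple_time S i.+1) t) w - W (Num.min (simple_time S i) t) w).

(* Convergence to 0 in probability of nonnegative variables. *)
Definition cvg_in_prob0 (Y : nat -> T -> \bar R) : Prop :=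
  forall e : R, 0 < e -> P [set w | (e%:E < Y n w)%E] @[n --> \oo] --> 0%E.

(* J is (a version of) the Ito integral of H against W over [0, t]: H is
   progressive and almost surely square integrable on [0, t], and J is the
   limit in probability of the integrals of simple processes S n such that
   int_0^t |S n - H|^2 ds tends to 0 in probability. *)
Definition is_ito_integral (F : R -> set_system T) (W : R -> T -> R)
    (H : R -> T -> R) (t : R) (J : T -> R) : Prop :=
  [/\ progressive F H,
      {ae P, forall w,
        (\int[lebesgue_measure]_(s in `[0%R, t]) ((H s w) ^+ 2)%R%:E < +oo)%E},
      measurable_fun setT J &
      exists S : nat -> simple_process,
        [/\ forall n, is_simple F (S n),
            cvg_in_prob0 (fun n w =>
              \int[lebesgue_measure]_(s in `[0%R, t])
                ((simple_eval (S n) s w - H s w) ^+ 2)%R%:E)%E &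
            cvg_in_prob0 (fun n w =>
              `|simple_integral W (S n) t w - J w|%:E)]].

(* Strong solution of dX = b(t, X) dt + sigma(t, X) dW with X_0 = X0. *)
Record is_sde_solution (F : R -> set_system T) (W : R -> T -> R) (X0 : T -> R)
    (b sigma : R -> R -> R) (X : R -> T -> R) : Prop := IsSdeSolution {
  sde_adapted : adapted F X ;
  sde_continuous : ae_continuous X ;
  sde_drift_progressive : progressive F (fun t w => b t (X t w)) ;
  sde_drift_integrable : forall t : R, 0 <= t -> {ae P, forall w,
    lebesgue_measure.-integrable `[0, t] (fun s => (b s (X s w))%:E)} ;
  sde_start : {ae P, forall w, X 0 w = X0 w} ;
  sde_equation : forall t : R, 0 <= t -> exists J : T -> R,
    is_ito_integral F W (fun s w => sigma s (X s w)) t J /\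
    {ae P, forall w, X t w =
      X0 w + (\int[lebesgue_measure]_(s in `[0, t]) b s (X s w)) + J w} }.

(* Existence of a strong solution and pathwise uniqueness. *)
Definition sde_well_posed (F : R -> set_system T) (W : R -> T -> R)
    (X0 : T -> R) (b sigma : R -> R -> R) : Prop :=
  (exists X, is_sde_solution F W X0 b sigma X) /\
  (forall X Y, is_sde_solution F W X0 b sigma X ->
     is_sde_solution F W X0 b sigma Y ->
     {ae P, forall w, forall t : R, 0 <= t -> X t w = Y t w}).

(* The xi k are standard normal, and X0, xi 0, xi 1, ... are mutually
   independent; taking B i = setT gives the product rule for subfamilies. *)
Definition fresh_standard_normals (X0 : T -> R) (xi : nat -> T -> R) : Prop :=
  (forall k, normally_distributed 0 1 (xi k)) /\
  (forall (n : nat) (A : set R) (B : nat -> set R),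
     measurable A -> (forall i, measurable (B i)) ->
     P (X0 @^-1` A `&` \bigcap_(i < n) (xi i @^-1` B i)) =
     (P (X0 @^-1` A) * \prod_(i < n) P (xi i @^-1` B i))%E).

End stochastic_calculus.

Section tamed_euler.
Context (R : realType).

Definition one_sided_lipschitz (K : R) (b : R -> R -> R) : Prop :=
  forall t x y, 0 <= t ->
    (x - y) * (b t x - b t y) <= K * `|x - y| ^+ 2.

Definition polynomial_growth (f : R -> R -> R) : Prop :=
  exists (C : R) (p : nat), forall t x, 0 <= t ->
    `|f t x| <= C * (1 + `|x| ^+ p).

Definition time_space_measurable (f : R -> R -> R) : Prop :=
  measurable_fun [set p : R * R | 0 <= p.1] (fun p : R * R => f p.1 p.2).

Definition truncation_level (h : R) : R := Num.sqrt (2 * `|ln h|).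

Definition truncation (h x : R) : R :=
  let A := truncation_level h in
  if A < x then A else if x < - A then - A else x.

Definition tamed_drift (b : R -> R -> R) (bhat_h : R -> R -> R) (t x : R) : R :=
  b t 0 + bhat_h t x.

(* [b_h] is the whole tamed drift, [tamed_drift b bhat_h] in the scheme. *)
Fixpoint tamed_euler (T : Type) (h : R) (b_h sigma_h : R -> R -> R)
    (X0 : T -> R) (xi : nat -> T -> R) (k : nat) (w : T) : R :=
  if k is k'.+1 then
    let x := tamed_euler h b_h sigma_h X0 xi k' w in
    let t := k'%:R * h in
    x + b_h t x * h + sigma_h t x * Num.sqrt h * truncation h (xi k' w)
  else X0 w.

End tamed_euler.

(* Main.v *)
Require Import Defs.
From mathcomp Require Import ring lra.
Import Order.TTheory GRing.Theory Num.Theory.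
Local Open Scope classical_set_scope.
Local Open Scope ring_scope.

(* The scheme is non-negative pathwise. From x >= 0 one step of it gives at
   least x (1 - mu h^(1-alpha) - mu h^((1-alpha)/2) A_h), because b(t,0) >= 0
   and the tamed coefficients are at most linear in x. With
   q = h^((1-alpha)/4), the correction is mu q^4 + mu q^2 A_h, and q A_h is
   bounded since q^2 |ln h| is, so the bracket is non-negative once q is
   small. *)

Lemma truncation_level_ge0 (R : realType) (h : R) : 0 <= truncation_level h.
Proof. exact: sqrtr_ge0. Qed.

Lemma norm_truncation_le (R : realType) (h x : R) :
  `|truncation h x| <= truncation_level h.
Proof.
have A0 := truncation_level_ge0 _ h.
rewrite /truncation; case: ltP => [_|xA]; first by rewrite ger0_norm.
case: ltP => [_|Ax]; first by rewrite normrN ger0_norm.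
by rewrite ler_norml Ax xA.
Qed.

(** Any positive power of [h] beats the logarithmic growth of the truncation level: squared, the
    claim reads [2 * e * |ln h| <= h ^ (-2e)]. *)
Lemma powR_mul_truncation_level_le (R : realType) (e h : R) :
  0 < e -> 0 < h -> h <= 1 ->
  h `^ e * truncation_level h <= Num.sqrt e^-1.
Proof.
move=> e0 h0 h1.
have q0 : 0 < h `^ e by exact: powR_gt0.
have lnh : ln h <= 0 by exact: ln_le0.
rewrite -(@ler_pXn2r _ 2) ?nnegrE ?mulr_ge0 ?truncation_level_ge0 ?sqrtr_ge0
  ?powR_ge0//.
rewrite exprMn !sqr_sqrtr ?invr_ge0 ?(ltW e0) ?mulr_ge0// ler0_norm//.
(* ln y <= y at y = h^(-2e) *)
have y0 : 0 < (h `^ e) ^- 2 by rewrite invr_gt0 exprn_gt0.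
have := le_ln1Dx (lt_trans (ltrN10 R) y0).
have : ln ((h `^ e) ^- 2) <= ln (1 + (h `^ e) ^- 2).
  by rewrite ler_ln ?posrE//; lra.
move=> /le_trans /[apply].
rewrite lnV ?posrE ?exprn_gt0// lnXn// ln_powR => le_ln.
rewrite -[leRHS]mul1r ler_pdivlMr//.
rewrite -mulrA -ler_pdivlMl ?exprn_gt0// mulr1; apply: le_trans le_ln.
by rewrite -mulr_natl; lra.
Qed.

Lemma small_step_level_le (R : realType) (mu u : R) : 0 < mu -> 0 < u ->
  exists2 h0 : R, 0 < h0 & forall h, 0 < h -> h < h0 ->
    mu * h `^ u + mu * h `^ (u / 2) * truncation_level h <= 1.
Proof.
(* The exponent [u / 2] is split into two equal halves: one factor [h ^ (u / 4)] will absorb the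
   level, the other will supply the smallness. *)
move=> mu0 u0; have e0 : 0 < u / 4 by rewrite divr_gt0.
set c := Num.sqrt (u / 4)^-1.
have c0 : 0 <= c by exact: sqrtr_ge0.
have C0 : 0 < mu * (1 + c) by rewrite mulr_gt0//; lra.
(* The second bound is the solution [h] of [h ^ (u / 4) * (mu * (1 + c)) = 1]; the bound 1 gives
   [q <= 1] and fixes the sign of [ln h]. *)
exists (Num.min 1 ((mu * (1 + c))^-1 `^ (u / 4)^-1)).
  by rewrite lt_min ltr01 powR_gt0// invr_gt0.
move=> h h0; rewrite lt_min => /andP[h1 hC].
have := powR_mul_truncation_level_le _ _ _ e0 h0 (ltW h1).
rewrite -/c; set A := truncation_level h; set q := h `^ (u / 4) => qA.
have q0 : 0 < q by exact: powR_gt0.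
have q1 : q <= 1.
  have : q <= 1 `^ (u / 4).
    by rewrite ge0_ler_powR ?nnegrE ?(ltW e0) ?(ltW h0) ?(ltW h1).
  by rewrite powR1.
have qC : q * (mu * (1 + c)) <= 1.
  rewrite -ler_pdivlMr// mul1r.
  have -> : (mu * (1 + c))^-1 = ((mu * (1 + c))^-1 `^ (u / 4)^-1) `^ (u / 4).
    by rewrite -powRrM mulVf ?gt_eqF// powRr1// invr_ge0 ltW.
  by rewrite ge0_ler_powR ?nnegrE ?powR_ge0 ?(ltW e0) ?(ltW h0) ?(ltW hC).
have -> : h `^ u = q ^+ 4.
  by rewrite -powR_mulrn ?powR_ge0// -powRrM divfK.
have -> : h `^ (u / 2) = q ^+ 2.
  by rewrite -powR_mulrn ?powR_ge0// -powRrM; congr powR; field.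
have q4 : q ^+ 4 <= q by rewrite ler_iXnr// ltW.
have : mu * q ^+ 4 <= mu * q by rewrite ler_pM2l.
(* Together the two terms are at most [mu * q * (1 + c)], which [qC] bounds by 1. *)
have : mu * q * (q * A) <= mu * q * c by rewrite ler_pM2l// mulr_gt0.
by lra.
Qed.

(** Here [b0] stands for [b t 0], [f] and [g] for the tamed coefficients at [x], and [z] for the
    truncated noise. The loss in one step is proportional to [x], so a small [h] keeps it below [x]
    itself. *)
Lemma tamed_step_ge0 (R : realType) (mu alpha h x b0 f g z : R) :
  0 < mu -> 0 < h -> 0 <= x -> 0 <= b0 ->
  Num.max (`|f| * h `^ alpha) (`|g| * h `^ (alpha / 2)) <= mu * `|x| ->
  `|z| <= truncation_level h ->
  mu * h `^ (1 - alpha) + mu * h `^ ((1 - alpha) / 2) * truncation_level h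
    <= 1 ->
  0 <= x + (b0 + f) * h + g * Num.sqrt h * z.
Proof.
move=> mu0 h0 x0 b00; rewrite ge_max (ger0_norm x0) => /andP[fx gx] zA small.
have hD p q : h `^ p * h `^ q = h `^ (p + q).
  by rewrite powRD// (gt_eqF h0) implybT.
have fh : `|f * h| <= mu * x * h `^ (1 - alpha).
  rewrite normrM (gtr0_norm h0) -[X in _ * X <= _](powRr1 (ltW h0)).
  (* In [h = h ^ alpha * h ^ (1 - alpha)] the first factor is consumed by the taming bound;
     [Num.sqrt h] is split likewise below. *)
  rewrite -[X in h `^ X](subrKC alpha) -hD mulrA.
  by rewrite ler_pM2r// powR_gt0.
have gh : `|g * Num.sqrt h * z| <=
    mu * x * h `^ ((1 - alpha) / 2) * truncation_level h.
  rewrite normrM ler_pM// normrM (ger0_norm (sqrtr_ge0 _)).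
  have -> : Num.sqrt h = h `^ (alpha / 2) * h `^ ((1 - alpha) / 2).
    by rewrite hD -powR12_sqrt ?ltW//; congr powR; field.
  by rewrite mulrA ler_wpM2r// powR_ge0.
have b0h : 0 <= b0 * h by rewrite mulr_ge0// ltW.
have := ler_wpM2l x0 small.
move: fh gh; rewrite !ler_norml => /andP[? _] /andP[? _].
by lra.
Qed.

Lemma tamed_euler_ge0 (R : realType) (T : Type) (mu alpha h : R)
    (b bhat_h sigma_h : R -> R -> R) (X0 : T -> R) (xi : nat -> T -> R)
    (k : nat) (w : T) :
  0 < mu -> 0 < h ->
  (forall t, 0 <= t -> 0 <= b t 0) ->
  (forall t x, 0 <= t ->
    Num.max (`|bhat_h t x| * h `^ alpha) (`|sigma_h t x| * h `^ (alpha / 2))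
      <= mu * `|x|) ->
  mu * h `^ (1 - alpha) + mu * h `^ ((1 - alpha) / 2) * truncation_level h
    <= 1 ->
  0 <= X0 w ->
  0 <= tamed_euler h (tamed_drift b bhat_h) sigma_h X0 xi k w.
Proof.
move=> mu0 h0 b0 bound small X00; elim: k => //= k IHk.
have t0 : 0 <= k%:R * h by rewrite mulr_ge0// ltW.
apply: (tamed_step_ge0 _ _ _ _ _ _ _ _ _ mu0 h0 IHk (b0 _ t0)
  (bound _ _ t0) _ small).
exact: norm_truncation_le.
Qed.

Theorem theorem4p1 (R : realType) (d : measure_display) (T : measurableType d)
  (P : probability T R)
  (F : R -> set_system T) (W : R -> T -> R) (X0 : {RV P >-> R})
  (b sigma : R -> R -> R)
  (* the tamed coefficients, with the step size h as first argument *)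
  (bhat_ sigma_ : R -> R -> R -> R)
  (K mu alpha : R)
  (F_filtration : is_filtration F)
  (W_wiener : is_wiener P F W)
  (X0_F0 : sub_measurable (F 0) X0)
  (X0_ge0 : {ae P, forall w, 0 <= X0 w})
  (sde_wp : sde_well_posed P F W X0 b sigma)
  (sigma_growth : polynomial_growth sigma)
  (b_lip : one_sided_lipschitz K b)
  (b0_ge0 : forall t, 0 <= t -> 0 <= b t 0)
  (sigma0 : forall t, 0 <= t -> sigma t 0 = 0)
  (bhat_meas : forall h, 0 < h -> time_space_measurable (bhat_ h))
  (sigma_meas : forall h, 0 < h -> time_space_measurable (sigma_ h))
  (mu_gt0 : 0 < mu) (alpha_gt0 : 0 < alpha)
  (tamed_bound : forall h, 0 < h -> forall t x, 0 <= t ->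
     Num.max (`|bhat_ h t x| * h `^ alpha) (`|sigma_ h t x| * h `^ (alpha / 2))
       <= mu * `|x|)
  (alpha_lt1 : alpha < 1) :
  exists2 h0 : R, 0 < h0 &
    forall h, 0 < h -> h < h0 ->
    forall xi : nat -> {RV P >-> R}, fresh_standard_normals P X0 xi ->
    forall k, {ae P, forall w,
      0 <= tamed_euler h (tamed_drift b (bhat_ h)) (sigma_ h) X0 xi k w}.
Proof.
have u0 : 0 < 1 - alpha by rewrite subr_gt0.
(* This threshold depends on [mu] and [alpha] only, so it serves all [xi] and [k]. *)
have [h0 h0_gt0 small] := small_step_level_le _ _ _ mu_gt0 u0.
exists h0 => // h h_gt0 h_lt xi _ k.
(* The exceptional null set is that of [X0], the same for every [k]. *)
apply: filterS X0_ge0 => w X0w.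
apply: (tamed_euler_ge0 _ _ _ _ _ _ _ _ _ _ _ _ mu_gt0 h_gt0 b0_ge0
  (tamed_bound _ h_gt0)
  (small _ h_gt0 h_lt) X0w).
Qed.
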